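(* The energy satisfaction problem for rational linear dynamical systems in dimension $4$ and polynomial weight functions with rational coefficients is Diophantine-hard. That is: if the energy satisfaction problem is decidable for $d=4$, then it is decidable, given $r\in\mathbb{Q}$ and $\lambda\in\mathbb{Q}(\mathbf{i})$, whether $u^{\lambda,r}_n\ge0$ for all $n\ge0$, where $$u^{\lambda,r}_n=r\,\operatorname{Im}(\lambda^n)-n\,\operatorname{Re}(\lambda^n)+n .$$
   Context: $\mathbb{Q}(\mathbf{i})=\{a+b\mathbf{i}: a,b\in\mathbb{Q}\}$ with $\mathbf{i}$ the imaginary unit. The energy satisfaction problem in dimension $d$ is: given $M\in\mathbb{Q}^{d\times d}$, $q\in\mathbb{Q}^d$, $B\in\mathbb{Q}$ and a polynomial $p$ in $d$ variables with rational coefficients, decide whether there exists $n$ such that $\sum_{k=0}^np(M^kq)<B$. Diophantine-hardness of a decision problem means that an algorithm for it would yield an algorithm deciding, for all $r\in\mathbb{Q}$ and $\lambda\in\mathbb{Q}(\mathbf{i})$, whether $u^{\lambda,r}_n\ge0$ for all $n\ge0$. *)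

(* Defs.v *)
From mathcomp Require Import all_boot all_order all_algebra.
From mathcomp Require Import complex.
From mathcomp Require Import mpoly.

Set Implicit Arguments.
Unset Strict Implicit.
Unset Printing Implicit Defensive.

Import GRing.Theory Num.Theory.
Local Open Scope ring_scope.
Local Open Scope complex_scope.

(* Kleene's partial recursive functions, by arity. *)
Inductive recfun : nat -> Type :=
| RZero n : recfun n
| RSucc : recfun 1
| RProj n : 'I_n -> recfun n
| RComp k n : recfun k -> ('I_k -> recfun n) -> recfun n
| RPrec n : recfun n -> recfun n.+2 -> recfun n.+1
| RMin n : recfun n.+1 -> recfun n.

(* [rec_eval f v y]: the partial function denoted by [f] is defined at [v],
   with value [y].  In [RPrec], the recursion argument comes first and [t] lists
   the successive values [t 0, ..., t (thead v)].  In [RMin], the searched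
   argument comes first, and all values before the first zero must be defined. *)
Fixpoint rec_eval n (f : recfun n) : n.-tuple nat -> nat -> Prop :=
  match f in recfun n return n.-tuple nat -> nat -> Prop with
  | RZero _ => fun _ y => y = 0%N
  | RSucc => fun v y => y = (thead v).+1
  | RProj _ i => fun v y => y = tnth v i
  | RComp k _ g h => fun v y =>
      exists2 w : k.-tuple nat,
        forall i, rec_eval (h i) v (tnth w i) & rec_eval g w y
  | RPrec _ g h => fun v y =>
      exists t : nat -> nat,
        [/\ rec_eval g [tuple of behead v] (t 0%N),
            forall i, (i < thead v)%N ->
              rec_eval h [tuple of i :: t i :: behead v] (t i.+1)
          & y = t (thead v)]
  | RMin _ g => fun v y =>
      rec_eval g [tuple of y :: v] 0%N
      /\ forall i, (i < y)%N -> exists z, rec_eval g [tuple of i :: v] z.+1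
  end.

(* [code c x]: the number [c] is a code of the instance [x].  An instance may
   have several codes; the algorithm must answer correctly on each of them, and
   its behaviour on numbers that code no instance is unconstrained. *)
Definition decidable_problem (A : Type) (code : nat -> A -> Prop)
    (Q : A -> Prop) : Prop :=
  exists f : recfun 1, forall (c : nat) (x : A), code c x ->
    (Q x -> rec_eval f [tuple c] 1%N) /\ (~ Q x -> rec_eval f [tuple c] 0%N).

(* Sign bit, and numerator and denominator in lowest terms. *)
Definition rat_code (x : rat) : nat :=
  CodeSeq.code [:: nat_of_bool (x < 0)%R; `|numq x|%N; `|denq x|%N].

Definition mx_code m n (M : 'M[rat]_(m, n)) : nat :=
  CodeSeq.code [seq rat_code (M i j) | i <- enum 'I_m, j <- enum 'I_n].

Definition term_code d (t : rat * 'X_{1..d}) : nat :=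
  CodeSeq.code (rat_code t.1 :: [seq t.2 i | i <- enum 'I_d]).

(* A polynomial is input as any finite list of terms whose sum it is. *)
Definition mpoly_code d (c : nat) (p : {mpoly rat[d]}) : Prop :=
  exists2 s : seq (rat * 'X_{1..d}),
    p = \sum_(t <- s) t.1 *: 'X_[t.2] & c = CodeSeq.code (map (@term_code d) s).

Record energy_instance (d : nat) := EnergyInstance {
  en_matrix : 'M[rat]_d;
  en_init : 'cV[rat]_d;
  en_bound : rat;
  en_weight : {mpoly rat[d]} }.

Definition energy_code d (c : nat) (e : energy_instance d) : Prop :=
  exists2 cp : nat, mpoly_code cp (en_weight e)
    & c = CodeSeq.code [:: mx_code (en_matrix e); mx_code (en_init e);
                           rat_code (en_bound e); cp].

Definition orbit_point d (M : 'M[rat]_d) (q : 'cV[rat]_d) (k : nat)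
  : 'cV[rat]_d := M ^+ k *m q.

Definition weight d (p : {mpoly rat[d]}) (x : 'cV[rat]_d) : rat :=
  p.@[fun i => x i 0].

Definition energy_sat d (e : energy_instance d) : Prop :=
  exists n : nat,
    \sum_(0 <= k < n.+1)
       weight (en_weight e) (orbit_point (en_matrix e) (en_init e) k)
    < en_bound e.

Definition energy_problem_decidable (d : nat) : Prop :=
  decidable_problem (@energy_code d) (@energy_sat d).

(* [rat[i]] is the field of Gaussian rationals. *)
Definition dioph_seq (lambda : rat[i]) (r : rat) (n : nat) : rat :=
  r * complex.Im (lambda ^+ n) - n%:R * complex.Re (lambda ^+ n) + n%:R.

Definition dioph_code (c : nat) (x : rat * rat[i]) : Prop :=
  c = CodeSeq.code [:: rat_code x.1; rat_code (complex.Re x.2);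
                       rat_code (complex.Im x.2)].

Definition dioph_positive (x : rat * rat[i]) : Prop :=
  forall n : nat, 0 <= dioph_seq x.2 x.1 n.

Definition dioph_decidable : Prop :=
  decidable_problem dioph_code dioph_positive.

Definition diophantine_hard (D : Prop) : Prop := D -> dioph_decidable.

(* Main.v *)
(* With [u k] the sequence of the Diophantine problem, the orbit
   [(Re (lambda ^ k), Im (lambda ^ k), w k, w)] is linear of dimension 4, and
   [w ^ 2 (u (k + 1) - u k)] is a polynomial in it.  The energies therefore
   telescope to [w ^ 2 u (n + 1)], and since [u 0 = 0] they drop below [0] iff
   [u] takes a negative value.
   For [r <> 0] take [w = r]: writing [r] as a coordinate keeps the coefficients
   of the polynomial among [0], [1], [-1] and the signed parts of [lambda], so
   that the code of the instance is obtained without computing any product in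
   lowest terms.  For [r = 0] take [w = 1] and drop the terms stemming from [r]. *)

From mathcomp Require Import all_boot all_order all_algebra.
From mathcomp Require Import complex mpoly ring.
From Stdlib Require Import Classical.
Require Import Defs.

Set Implicit Arguments.
Unset Strict Implicit.
Unset Printing Implicit Defensive.

Import Order.TTheory GRing.Theory Num.Theory.

(** * Closure properties of total recursive functions *)

Definition recursive n (F : n.-tuple nat -> nat) : Prop :=
  exists f : recfun n, forall v, rec_eval f v (F v).

Definition recursive1 (F : nat -> nat) : Prop :=
  recursive (fun v : 1.-tuple nat => F (nth 0 v 0)).

Definition recursive2 (F : nat -> nat -> nat) : Prop :=
  recursive (fun v : 2.-tuple nat => F (nth 0 v 0) (nth 0 v 1)).

Definition recursive3 (F : nat -> nat -> nat -> nat) : Prop :=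
  recursive (fun v : 3.-tuple nat => F (nth 0 v 0) (nth 0 v 1) (nth 0 v 2)).

Lemma eq_recursive n (F G : n.-tuple nat -> nat) :
  F =1 G -> recursive F -> recursive G.
Proof. by move=> eqFG [f fP]; exists f => v; rewrite -eqFG. Qed.

Lemma recursive_nth n i : i < n -> recursive (fun v : n.-tuple nat => nth 0 v i).
Proof.
by move=> lt_in; exists (RProj (Ordinal lt_in)) => v /=; rewrite (tnth_nth 0).
Qed.

Lemma recursive_comp1 n F (G : n.-tuple nat -> nat) :
  recursive1 F -> recursive G -> recursive (fun v => F (G v)).
Proof.
move=> [f fP] [g gP]; exists (RComp f (fun=> g)) => v /=.
by exists [tuple G v] => [i|]; [rewrite ord1; apply: gP | apply: (fP [tuple G v])].
Qed.

Lemma recursive_comp2 n F (G H : n.-tuple nat -> nat) :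
  recursive2 F -> recursive G -> recursive H ->
  recursive (fun v => F (G v) (H v)).
Proof.
move=> [f fP] [g gP] [h hP].
exists (RComp f (fun i : 'I_2 => if i == ord0 then g else h)) => v /=.
exists [tuple G v; H v]; last exact: (fP [tuple G v; H v]).
by case=> [[|[|//]] lt_i]; rewrite (tnth_nth 0); [apply: gP | apply: hP].
Qed.

Lemma recursive_succ n (F : n.-tuple nat -> nat) :
  recursive F -> recursive (fun v => (F v).+1).
Proof.
by apply: recursive_comp1; exists RSucc => v /=; rewrite /thead (tnth_nth 0).
Qed.

Lemma recursive_const n k : recursive (fun _ : n.-tuple nat => k).
Proof.
by elim: k => [|k IHk]; [exists (RZero n) | apply: recursive_succ].
Qed.

Lemma recursive_prec F g h :
  recursive1 g -> recursive3 h ->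
  (forall x, F 0 x = g x) -> (forall i x, F i.+1 x = h i (F i x) x) ->
  recursive2 F.
Proof.
move=> [f fP] [k kP] F0 FS; exists (RPrec f k) => v /=.
exists (F^~ (nth 0 v 1)); split; last by rewrite /thead (tnth_nth 0).
  by have := fP [tuple of behead v]; rewrite F0 /= nth_behead.
move=> i _.
have := kP [tuple of i :: F i (nth 0 v 1) :: behead v].
by rewrite FS /= nth_behead.
Qed.

Lemma recursive_min n (G : n.+1.-tuple nat -> nat) (F : n.-tuple nat -> nat) :
  recursive G -> (forall v, G [tuple of F v :: v] = 0) ->
  (forall v i, i < F v -> 0 < G [tuple of i :: v]) -> recursive F.
Proof.
move=> [g gP] G0 Gpos; exists (RMin g) => v /=; split=> [|i lt_i].
  by rewrite -[X in rec_eval _ _ X](G0 v); apply: gP.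
exists (G [tuple of i :: v]).-1.
by rewrite prednK; [apply: gP | apply: Gpos].
Qed.

(** A dummy second argument brings unary functions within reach of [recursive_prec], which yields
    binary ones. *)
Lemma recursive_fst F : recursive2 (fun n _ => F n) -> recursive1 F.
Proof.
move=> rF; apply: (recursive_comp2 rF (recursive_nth _) (recursive_const _ 0)).
exact: isT.
Qed.

Lemma recursive2_add : recursive2 addn.
Proof.
apply: (@recursive_prec _ id (fun _ t _ => t.+1)) => //.
  exact: recursive_nth.
by apply: recursive_succ; apply: recursive_nth.
Qed.

Lemma recursive2_mul : recursive2 muln.
Proof.
apply: (@recursive_prec _ (fun=> 0) (fun _ t x => x + t)) => //.
  exact: recursive_const.
by apply: (recursive_comp2 recursive2_add); apply: recursive_nth.
Qed.

Lemma recursive1_pred : recursive1 predn.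
Proof.
apply: recursive_fst; apply: (@recursive_prec _ (fun=> 0) (fun i _ _ => i)) => //.
  exact: recursive_const.
exact: recursive_nth.
Qed.

(** The arguments are swapped because the recursion runs on the first one, here the subtrahend. *)
Lemma recursive2_subr : recursive2 (fun n m => m - n).
Proof.
apply: (@recursive_prec _ id (fun _ t _ => t.-1)) => [|||i x].
- exact: recursive_nth.
- by apply: (recursive_comp1 recursive1_pred); apply: recursive_nth.
- exact: subn0.
- by rewrite subnS.
Qed.

Lemma recursive_add n (F G : n.-tuple nat -> nat) :
  recursive F -> recursive G -> recursive (fun v => F v + G v).
Proof. exact: recursive_comp2 recursive2_add. Qed.

Lemma recursive_mul n (F G : n.-tuple nat -> nat) :
  recursive F -> recursive G -> recursive (fun v => F v * G v).
Proof. exact: recursive_comp2 recursive2_mul. Qed.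

Lemma recursive_sub n (F G : n.-tuple nat -> nat) :
  recursive F -> recursive G -> recursive (fun v => F v - G v).
Proof. by move=> rF rG; apply: (recursive_comp2 recursive2_subr rG rF). Qed.

Lemma recursive_if0 n (F G H : n.-tuple nat -> nat) :
  recursive F -> recursive G -> recursive H ->
  recursive (fun v => if F v == 0 then G v else H v).
Proof.
move=> rF rG rH.
(* Truncated subtraction makes [1 - F v] the indicator of [F v = 0], and [1 - (1 - F v)] that of its
   negation. *)
apply: (@eq_recursive _ (fun v => (1 - F v) * G v + (1 - (1 - F v)) * H v)).
  by move=> v; case: (F v) => [|m]; rewrite ?subSS ?sub0n ?mul0n ?mul1n ?addn0.
by apply: recursive_add; apply: recursive_mul => //;
   do ?[apply: recursive_sub]; rewrite //; apply: recursive_const.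
Qed.

(** * Parity, halving and the exponent of two *)

Lemma recursive1_odd : recursive1 odd.
Proof.
apply: recursive_fst; apply: (@recursive_prec _ (fun=> 0) (fun _ t _ => 1 - t)).
- exact: recursive_const.
- by apply: recursive_sub; [apply: recursive_const | apply: recursive_nth].
- by [].
- by move=> i _ /=; case: (odd i).
Qed.

Lemma recursive1_half : recursive1 half.
Proof.
apply: recursive_fst.
apply: (@recursive_prec _ (fun=> 0) (fun i t _ => odd i + t)) => //.
- exact: recursive_const.
- apply: recursive_add; last exact: recursive_nth.
  by apply: (recursive_comp1 recursive1_odd); apply: recursive_nth.
- by move=> i _; rewrite -uphalf_half.
Qed.

Lemma recursive2_iter_half : recursive2 (fun n => iter n half).
Proof.
apply: (@recursive_prec _ id (fun _ t _ => t./2)) => //.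
  exact: recursive_nth.
by apply: (recursive_comp1 recursive1_half); apply: recursive_nth.
Qed.

Lemma recursive1_exp2 : recursive1 (expn 2).
Proof.
apply: recursive_fst; apply: (@recursive_prec _ (fun=> 1) (fun _ t _ => t + t)).
- exact: recursive_const.
- by apply: recursive_add; apply: recursive_nth.
- by [].
- by move=> i _; rewrite expnS mul2n addnn.
Qed.

Lemma iter_half_exp2 n k m : n <= k -> iter n half (2 ^ k * m) = 2 ^ (k - n) * m.
Proof.
elim: n => [|n IHn] le_nk; first by rewrite subn0.
by rewrite iterS IHn 1?ltnW // -(subnSK le_nk) expnS -mulnA mul2n doubleK.
Qed.

(** [c] is [2 ^ logn 2 c] times an odd [m], so the first [logn 2 c] halvings are exact. *)
Lemma iter_half_logn2 c : 0 < c ->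
  exists2 m, odd m &
    forall n, n <= logn 2 c -> iter n half c = 2 ^ (logn 2 c - n) * m.
Proof.
move=> c_gt0; have [m m_odd def_c] := pfactor_coprime (isT : prime 2) c_gt0.
exists m => [|n le_n]; first by rewrite -coprime2n.
by rewrite -iter_half_exp2 // mulnC -def_c.
Qed.

Lemma recursive1_logn2 : recursive1 (logn 2).
Proof.
(* Minimisation finds the first number of halvings with an odd result. The factor [nth 0 v 1] stops
   the search at once on [0], whose halves are never odd and for which [logn 2 0 = 0]. *)
pose G (v : 2.-tuple nat) :=
  nth 0 v 1 * (1 - odd (iter (nth 0 v 0) half (nth 0 v 1))).
apply: (@recursive_min _ G).
- apply: recursive_mul; first exact: recursive_nth.
  apply: recursive_sub; first exact: recursive_const.
  apply: (recursive_comp1 recursive1_odd).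
  by apply: (recursive_comp2 recursive2_iter_half); apply: recursive_nth.
- move=> v; rewrite /G /=; set c := nth 0 v 0.
  case: (posnP c) => [->//|/iter_half_logn2[m m_odd ->//]].
  by rewrite subnn mul1n m_odd muln0.
- move=> v i; rewrite /G /=; set c := nth 0 v 0 => lt_i.
  have c_gt0 : 0 < c by case: posnP lt_i => // ->; rewrite logn0.
  have [m _ half_c] := iter_half_logn2 c_gt0.
  rewrite (half_c _ (ltnW lt_i)) muln_gt0 c_gt0.
  by rewrite -(subnSK lt_i) expnS -mulnA mul2n odd_double.
Qed.

(** * Encoding and decoding of lists and rationals *)

#[local] Arguments CodeSeq.code : simpl never.

(** On the code of [x :: s], [x] halvings remove the power of two, and one more turns the odd factor
    [2 m + 1] into [m], the code of [s]. *)
Definition code_tail (c : nat) : nat := iter (logn 2 c).+1 half c.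

Definition code_nth (i c : nat) : nat := logn 2 (iter i code_tail c).

Lemma code_cons x s : CodeSeq.code (x :: s) = 2 ^ x * (CodeSeq.code s).*2.+1.
Proof. by []. Qed.

Lemma logn_code x s : logn 2 (CodeSeq.code (x :: s)) = x.
Proof.
rewrite code_cons lognM ?expn_gt0 // pfactorK // lognE /=.
by rewrite dvdn2 /= odd_double addn0.
Qed.

Lemma code_tailE s : code_tail (CodeSeq.code s) = CodeSeq.code (behead s).
Proof.
(* The empty list has code [0], fixed by halving just as [behead] fixes the list. *)
case: s => [|x s]; first by rewrite /code_tail logn0.
rewrite /code_tail logn_code iterS code_cons iter_half_exp2 // subnn mul1n.
by rewrite [half _]uphalf_double.
Qed.

Lemma code_nthE i s : code_nth i (CodeSeq.code s) = nth 0 s i.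
Proof.
rewrite /code_nth; elim: i s => [|i IHi] s.
  by case: s => [|x s]; rewrite ?logn_code // logn0.
by rewrite iterSr code_tailE IHi nth_behead.
Qed.

Lemma recursive_code_nth n i (F : n.-tuple nat -> nat) :
  recursive F -> recursive (fun v => code_nth i (F v)).
Proof.
move=> rF; apply: (recursive_comp1 recursive1_logn2).
elim: i => //= i; apply: recursive_comp1.
apply: (recursive_comp2 recursive2_iter_half).
  by apply: recursive_succ; apply: recursive1_logn2.
exact: recursive_nth.
Qed.

Lemma recursive_code_cons n (F : n.-tuple nat -> nat) L :
  recursive F -> recursive (fun v => CodeSeq.code (L v)) ->
  recursive (fun v => CodeSeq.code (F v :: L v)).
Proof.
move=> rF rL; apply: recursive_mul.
  exact: recursive_comp1 recursive1_exp2 rF.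
apply: recursive_succ; apply: (eq_recursive _ (recursive_add rL rL)) => v.
exact: addnn.
Qed.

(** Negation preserves lowest terms, so only the sign bit changes; at zero it must stay [0]. *)
Definition neg_code (c : nat) : nat :=
  CodeSeq.code [:: if code_nth 1 c == 0 then 0 else 1 - code_nth 0 c;
                   code_nth 1 c; code_nth 2 c].

Lemma neg_codeE (x : rat) : neg_code (rat_code x) = rat_code (- x)%R.
Proof.
rewrite /neg_code /rat_code !code_nthE /= numqN denqN abszN absz_eq0 numq_eq0.
by rewrite oppr_lt0; case: (ltrgt0P x).
Qed.

Lemma recursive_neg_code n (F : n.-tuple nat -> nat) :
  recursive F -> recursive (fun v => neg_code (F v)).
Proof.
move=> rF; apply: recursive_code_cons.
  apply: recursive_if0; [exact: recursive_code_nth | exact: recursive_const |].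
  by apply: recursive_sub; [apply: recursive_const | apply: recursive_code_nth].
by do 2![apply: recursive_code_cons; first exact: recursive_code_nth];
   apply: recursive_const.
Qed.

(** * The reduction on instances and on codes *)

Section Data.
Variable T : Type.

(* Stated for any [T], so as to be used both at [rat] and at the codes of
   rationals; [na], [nb], [nl] stand for the opposites of [a], [b] and of [l = 1]. *)
Definition matrix_rows (a b nb o l : T) : seq (seq T) :=
  [:: [:: a; nb; o; o]; [:: b; a; o; o]; [:: o; o; l; l]; [:: o; o; o; l]].

(** The exponents are those of the four coordinates. The monomial [[:: 1; 0; 1; 1]] stays split over
    two terms, which avoids computing the code of [1 - a]. *)
Definition base_terms (b na l : T) : seq (T * seq nat) :=
  [:: (na, [:: 1; 0; 1; 1]); (b, [:: 0; 1; 1; 1]); (na, [:: 1; 0; 0; 2]);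
      (b, [:: 0; 1; 0; 2]); (l, [:: 0; 0; 0; 2]); (l, [:: 1; 0; 1; 1])].

(** Contribution of the imaginary parts: with [w = r], the factor [w ^ 2 * r] becomes [w ^ 3]. *)
Definition ratio_terms (a b nl : T) : seq (T * seq nat) :=
  [:: (b, [:: 1; 0; 0; 3]); (a, [:: 0; 1; 0; 3]); (nl, [:: 0; 1; 0; 3])].

End Data.

Definition weight_terms (r a b : rat) : seq (rat * seq nat) :=
  (if r == 0 then base_terms b (- a) 1
   else ratio_terms a b (-1) ++ base_terms b (- a) 1)%R.

Definition red_matrix (a b : rat) : 'M[rat]_4 :=
  (\matrix_(i, j) nth 0 (nth [::] (matrix_rows a b (- b) 0 1) i) j)%R.

Definition nonzero_ratio (r : rat) : rat := (if r == 0 then 1 else r)%R.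

Definition red_init (r : rat) : 'cV[rat]_4 :=
  (\col_i nth 0 [:: 1; 0; 0; nonzero_ratio r] i)%R.

Definition red_term (t : rat * seq nat) : rat * 'X_{1..4} :=
  (t.1, [multinom nth 0 t.2 i | i < 4]).

Definition red_weight (r a b : rat) : {mpoly rat[4]} :=
  (\sum_(t <- map red_term (weight_terms r a b)) t.1 *: 'X_[t.2])%R.

Definition reduction (x : rat * rat[i]%C) : energy_instance 4 :=
  let a := complex.Re x.2 in let b := complex.Im x.2 in
  EnergyInstance (red_matrix a b) (red_init x.1) 0%R (red_weight x.1 a b).

Definition terms_code (s : seq (nat * seq nat)) : nat :=
  CodeSeq.code [seq CodeSeq.code (t.1 :: t.2) | t <- s].

(** On the code of an instance, [n] is the absolute numerator of [r], so [n == 0] tests [r = 0]. *)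
Definition red_code (c : nat) : nat :=
  let rc := code_nth 0 c in let ac := code_nth 1 c in let bc := code_nth 2 c in
  let n := code_nth 1 rc in
  let one := rat_code 1%R in let zero := rat_code 0%R in
  let base := base_terms bc (neg_code ac) one in
  CodeSeq.code
    [:: CodeSeq.code (flatten (matrix_rows ac bc (neg_code bc) zero one));
        CodeSeq.code [:: one; zero; zero; if n == 0 then one else rc];
        zero;
        if n == 0 then terms_code base
        else terms_code (ratio_terms ac bc (rat_code (-1)%R) ++ base)].

Lemma recursive1_red_code : recursive1 red_code.
Proof.
rewrite /recursive1 /red_code /terms_code /=.
(* Only syntactic matching is safe here: a failing unification would unfold the
   codes and compute huge unary numbers. *)
repeat lazymatch goal with
  | |- recursive (fun v => CodeSeq.code (@?F v :: @?L v)) =>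
    apply: (@recursive_code_cons _ F L)
  | |- recursive (fun v => if _ then _ else _) => apply: recursive_if0
  | |- recursive (fun v => code_nth ?i (@?F v)) =>
    apply: (@recursive_code_nth _ i F)
  | |- recursive (fun v => neg_code (@?F v)) => apply: (@recursive_neg_code _ F)
  | |- recursive (fun _ => ?k) => exact: (@recursive_const _ k)
  end.
all: exact: recursive_nth.
Qed.

(** Naturality in the entry type, used to match rows built from codes with the codes of rational
    rows. *)
Lemma matrix_rows_map T U (f : T -> U) a b nb o l :
  flatten (matrix_rows (f a) (f b) (f nb) (f o) (f l)) =
  map f (flatten (matrix_rows a b nb o l)).
Proof. by []. Qed.

Lemma mx_code_red_matrix a b :
  mx_code (red_matrix a b) =
  CodeSeq.code (map rat_code (flatten (matrix_rows a b (- b)%R 0%R 1%R))).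
Proof.
congr CodeSeq.code.
by rewrite !enum_ordSl enum_ord0 /= /red_matrix !mxE.
Qed.

Lemma mx_code_red_init r :
  mx_code (red_init r) =
  CodeSeq.code (map rat_code [:: 1; 0; 0; nonzero_ratio r]%R).
Proof.
congr CodeSeq.code.
by rewrite !enum_ordSl !enum_ord0 /= /red_init !mxE.
Qed.

Lemma term_code_red x (s : seq nat) : size s = 4 ->
  term_code (red_term (x, s)) = CodeSeq.code (rat_code x :: s).
Proof.
case: s => [|i [|j [|k [|l [|//]]]]] // _; congr CodeSeq.code.
by rewrite !enum_ordSl enum_ord0 /= !mnmE.
Qed.

Lemma red_codeP c x : dioph_code c x -> energy_code (red_code c) (reduction x).
Proof.
case: x => r [a b]; rewrite /dioph_code /= => ->.
exists (CodeSeq.code (map (@term_code 4) (map red_term (weight_terms r a b)))).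
  by exists (map red_term (weight_terms r a b)).
rewrite /red_code !code_nthE /=.
rewrite mx_code_red_matrix mx_code_red_init !neg_codeE.
rewrite -(matrix_rows_map rat_code) /weight_terms /nonzero_ratio.
rewrite !absz_eq0 !numq_eq0.
rewrite /terms_code /reduction /=.
by case: eqP => _ /=; rewrite !term_code_red.
Qed.

(** * Telescoping of the energies and correctness of the reduction *)

Local Open Scope ring_scope.

(** The upper left block of the matrix is multiplication by [z] on real and imaginary parts; the
    lower right one adds the constant [w] to the third coordinate. *)
Lemma orbit_pointE r (z : rat[i]%C) k :
  let w := nonzero_ratio r in
  orbit_point (red_matrix (complex.Re z) (complex.Im z)) (red_init r) k =
  \col_i nth 0 [:: complex.Re (z ^+ k); complex.Im (z ^+ k); w * k%:R; w] i.
Proof.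
move=> w; rewrite /orbit_point; elim: k => [|k IHk].
  by rewrite expr0 mul1mx; apply/colP => i; rewrite !mxE mulr0.
rewrite exprS -mulmxA IHk exprS; apply/colP => i.
rewrite !mxE !big_ord_recl big_ord0 !mxE /=.
case: (z ^+ k) => c d; case: z {IHk} => a b /=.
by case: i => [[|[|[|[|//]]]] lt_i] /=; rewrite -?natr1; ring.
Qed.

(** This form displays the next orbit point: [a * x - b * y] and [b * x + a * y] are its real and
    imaginary parts, [z + w] its third coordinate. *)
Lemma weightE r a b x y z w :
  weight (red_weight r a b) (\col_i nth 0 [:: x; y; z; w] i) =
  (r != 0)%:R * (w ^+ 3 * (b * x + a * y - y))
  - w * (z + w) * (a * x - b * y) + w * (z + w) + w * z * x - w * z.
Proof.
rewrite /weight /red_weight raddf_sum big_map.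
under eq_bigr => t _ do
  rewrite /= mevalZ mevalX !big_ord_recl big_ord0 !mnmE !mxE /=.
by rewrite /weight_terms; case: eqP => _; rewrite ?big_cons big_nil /=; ring.
Qed.

Lemma energy_sumE x n :
  \sum_(0 <= k < n.+1)
     weight (en_weight (reduction x))
       (orbit_point (en_matrix (reduction x)) (en_init (reduction x)) k) =
  nonzero_ratio x.1 ^+ 2 * dioph_seq x.2 x.1 n.+1.
Proof.
pose u k := nonzero_ratio x.1 ^+ 2 * dioph_seq x.2 x.1 k.
rewrite -[RHS]/(u n.+1) (_ : u n.+1 = u n.+1 - u 0); last first.
  by rewrite /u /dioph_seq expr0 /=; ring.
rewrite -telescope_sumr //; apply: eq_bigr => k _.
rewrite orbit_pointE weightE /u /dioph_seq (exprS x.2) /nonzero_ratio.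
case: x @u => r [a b] _ /=; case: ((a +i* b)%C ^+ k) => c d /=.
(* For [r = 0] the indicator kills the terms in [w ^ 3]; otherwise [w = r]. *)
by rewrite -natr1; case: eqP => [->|_] /=; ring.
Qed.

Lemma energy_sat_reduction x :
  energy_sat (reduction x) <-> exists n, dioph_seq x.2 x.1 n < 0.
Proof.
have w2_gt0 : 0 < nonzero_ratio x.1 ^+ 2.
  by rewrite exprn_even_gt0 //= /nonzero_ratio; case: ifP => // ->.
split=> [[n]|[[|n] lt_u]].
  by rewrite energy_sumE pmulr_rlt0 //; exists n.+1.
  (* The sums only reach indices [n.+1]; nothing is lost, as the sequence vanishes at [0]. *)
  by move: lt_u; rewrite /dioph_seq expr0 /= mulr0 mul0r subr0 addr0 ltxx.
by exists n; rewrite energy_sumE pmulr_rlt0.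
Qed.

Theorem theorem31 : diophantine_hard (energy_problem_decidable 4).
Proof.
move=> [f fP]; have [g gP] := recursive1_red_code.
(* [h] exchanges the two answers, since energy satisfaction is the failure of positivity. *)
have [h hP] : recursive1 (fun n => 1 - n)%N.
  by apply: recursive_sub; [apply: recursive_const | apply: recursive_nth].
exists (RComp h (fun=> RComp f (fun=> g))) => c x cx.
have [sat_f unsat_f] := fP _ _ (red_codeP cx).
have run b : rec_eval f [tuple red_code c] b ->
    rec_eval (RComp h (fun=> RComp f (fun=> g))) [tuple c] (1 - b)%N.
  move=> fb; exists [tuple b]; last exact: (hP [tuple b]).
  move=> i; rewrite ord1; exists [tuple red_code c] => // j.
  by rewrite ord1; apply: (gP [tuple c]).
split=> [pos_x|npos_x].
  apply/(run 0)/unsat_f => /energy_sat_reduction[n].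
  by rewrite ltNge pos_x.
apply/(run 1)/sat_f/energy_sat_reduction.
(* Classical logic extracts from the failure of positivity an index with a negative value. *)
have [n npos_n] := not_all_ex_not _ _ npos_x.
by exists n; rewrite ltNge; apply/negP.
Qed.
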